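(* Let $\tau>0$, let $r_k,m_k\ge 1$, let $\Sigma_k'\in\mathbb{R}^{r_k\times r_k}$ be a diagonal matrix all of whose diagonal entries are $\ge\tau$, and let $$R_{k+1}=\begin{bmatrix}\Sigma_k'&*\\0&\widetilde R\end{bmatrix}\in\mathbb{R}^{(r_k+m_k)\times(r_k+m_k)}$$ with $\widetilde R\in\mathbb{R}^{m_k\times m_k}$ the upper triangular factor of a QR decomposition with column pivoting and $*$ an arbitrary $r_k\times m_k$ block. Let $r_{k+1}$ be the number of singular values retained when the SVD thresholding procedure (see context) with threshold $\tau$ is applied to $R_{k+1}$. Then the thresholding strategy is rank increasing, i.e. $r_{k+1}\ge r_k$.
   Context: $\Sigma_k'$ is the diagonal matrix of retained singular values from the previous step of an SVD updating process, itself obtained by thresholding with level $\tau$ (hence its diagonal entries are $\ge\tau$). Column pivoting means that the entries of $\widetilde R=[\tilde r_{ij}]$ satisfy $|\tilde r_{11}|\ge\cdots\ge|\tilde r_{m_k,m_k}|$ and $|\tilde r_{jj}|\ge|\tilde r_{j\ell}|$ for $\ell\ge j$. **SVD thresholding procedure with threshold $\tau$.** Put $n=r_k+m_k$ and let $\rho_1,\dots,\rho_n$ be the diagonal entries of $R_{k+1}$. 1. Let $m=\min\left\{j\in\{0,\dots,n-1\}:|\rho_{j+1}|\le\sqrt{\tfrac{2}{(n-j)(n-j+1)}}\,\tau\right\}$, with $m=n$ if this set is empty, and partition $R_{k+1}=\begin{bmatrix}R_{11}&R_{12}\\0&R_{22}\end{bmatrix}$ with $R_{11}\in\mathbb{R}^{m\times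 m}$. 2. Replace $R_{22}$ by $0$, obtaining $\hat R_{k+1}=\begin{bmatrix}R_{11}&R_{12}\\0&0\end{bmatrix}$. 3. Compute the singular values of $\hat R_{k+1}$ and retain exactly those that are $\ge\tau$; those $<\tau$ are set to zero. The number of retained singular values is $r_{k+1}$. *)

(* Defs.v *)
From mathcomp Require Import all_boot all_order all_fingroup all_algebra.
From mathcomp Require Import polyrcf.

Set Implicit Arguments.
Unset Strict Implicit.
Unset Printing Implicit Defensive.

Import Order.TTheory GRing.Theory Num.Theory.
Local Open Scope ring_scope.

Section Thresholding.
Variable R : rcfType.

(* The singular values of a square matrix, each repeated according to its
   multiplicity: the square roots of the eigenvalues of A^T A, i.e. of the roots
   of its characteristic polynomial counted with multiplicity.  [rootsR p] lists
   the distinct real roots of p, and A^T A being symmetric, all n eigenvalues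
   are real. *)
Definition singular_values n (A : 'M[R]_n) : seq R :=
  let chi := char_poly (A^T *m A) in
  flatten [seq nseq (mup x chi) (Num.sqrt x) | x <- rootsR chi].

(* Zero-based indices. *)
Definition column_pivoted m (T : 'M[R]_m) : Prop :=
  (forall i j : 'I_m, (i <= j)%N -> `|T j j| <= `|T i i|) /\
  (forall j l : 'I_m, (j <= l)%N -> `|T j l| <= `|T j j|).

(* B P = Q T, where P is the column permutation given by s, Q has orthonormal
   columns and T is square and upper triangular ([is_trig_mx] means lower
   triangular, hence the transpose). *)
Definition pivoted_qr p m (B : 'M[R]_(p, m)) (s : 'S_m)
    (Q : 'M[R]_(p, m)) (T : 'M[R]_m) : Prop :=
  [/\ col_perm s B = Q *m T, Q^T *m Q = 1%:M, is_trig_mx T^T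
    & column_pivoted T].

(* The diagonal entry rho_{j+1} is [A j j] for [j : 'I_n].  [find] returns the
   first position satisfying the test, and n when there is none; since j < n the
   natural-number subtraction is not truncated. *)
Definition split_index n (tau : R) (A : 'M[R]_n) : nat :=
  find (fun j : 'I_n =>
          `|A j j| <= Num.sqrt (2 / ((n - j) * (n - j + 1))%:R) * tau)
       (enum 'I_n).

Definition zero_trailing_block n (m : nat) (A : 'M[R]_n) : 'M[R]_n :=
  \matrix_(i, j) if (m <= i)%N && (m <= j)%N then 0 else A i j.

Definition retained_singular_values n (tau : R) (A : 'M[R]_n) : seq R :=
  [seq x <- singular_values (zero_trailing_block (split_index tau A) A)
     | tau <= x].

Definition thresholded_rank n (tau : R) (A : 'M[R]_n) : nat :=
  size (retained_singular_values tau A).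

End Thresholding.

(* Main.v *)
(* The first [rk] diagonal entries are [>= tau], whereas each of the first [rk]
   thresholds is [< tau] because [mk >= 1]; hence truncation happens at an index
   [>= rk] and leaves the first [rk] columns of the matrix untouched.  The
   truncated matrix [M] thus sends every vector [v] supported on the first [rk]
   coordinates to a vector of norm at least [tau |v|], and by the Courant-Fischer
   principle [M^T M] has at least [rk] eigenvalues [>= tau^2].  As the spectral
   theorem is available over closed fields, eigenvalues are counted over [R[i]]. *)
Require Import Defs.
From mathcomp Require Import all_boot all_order all_fingroup all_algebra.
From mathcomp Require Import polyrcf complex.

Set Implicit Arguments.
Unset Strict Implicit.
Unset Printing Implicit Defensive.

Import Order.TTheory GRing.Theory Num.Theory.
Local Open Scope ring_scope.
Local Open Scope sesquilinear_scope.

Lemma char_poly_conj (F : fieldType) n (P B : 'M[F]_n) :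
  P \in unitmx -> char_poly (invmx P *m B *m P) = char_poly B.
Proof.
move=> Punit; rewrite /char_poly.
have -> : char_poly_mx (invmx P *m B *m P) =
    map_mx polyC (invmx P) *m char_poly_mx B *m map_mx polyC P.
  rewrite /char_poly_mx !map_mxM mulmxBr mulmxBl; congr (_ - _).
  by rewrite scalar_mxC -mulmxA -map_mxM mulVmx// map_mx1 mulmx1.
by rewrite 2!det_mulmx mulrAC -det_mulmx -map_mxM mulVmx// map_mx1 det1 mul1r.
Qed.

Lemma char_poly_hermitian (C : numClosedFieldType) n (A : 'M[C]_n) :
  A \is hermsymmx -> char_poly A = \prod_i ('X - (spectral_diag A 0 i)%:P).
Proof.
move=> /hermitian_normalmx /orthomx_spectralP /= {1}->.
rewrite char_poly_conj ?spectral_unit// char_poly_trig ?diag_mx_is_trig//.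
by apply: eq_bigr => i _; rewrite mxE eqxx mulr1n.
Qed.

Lemma dotmx_sum (C : numClosedFieldType) n (v : 'rV[C]_n) :
  (v *m v^t* ) 0 0 = \sum_i `|v 0 i| ^+ 2.
Proof. by rewrite mxE; apply: eq_bigr => i _; rewrite !mxE normCK. Qed.

Lemma diag_form_sum (C : numClosedFieldType) n (d v : 'rV[C]_n) :
  (v *m diag_mx d *m v^t* ) 0 0 = \sum_i d 0 i * `|v 0 i| ^+ 2.
Proof.
rewrite mxE; apply: eq_bigr => i _.
by rewrite mul_mx_diag !mxE normCK mulrAC mulrC.
Qed.

(* If fewer than [k] eigenvalues were [>= c], some nonzero [v] in the row space
   of [U] would be orthogonal to all their eigenvectors, so that
   [v A v* < c v v*]. *)
Lemma hermitian_count_ge (C : numClosedFieldType) n k (A : 'M[C]_n)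
    (U : 'M[C]_(k, n)) (c : C) :
  A \is hermsymmx -> c \is Num.real -> row_free U ->
  (forall x : 'rV_k, c * (x *m U *m (x *m U)^t* ) 0 0 <=
                     (x *m U *m A *m (x *m U)^t* ) 0 0) ->
  (k <= #|[pred i | (c <= spectral_diag A 0 i)%R]|)%N.
Proof.
move=> hermA creal Ufree leform; rewrite leqNgt; apply/negP => ltk.
set S := [pred i | _] in ltk.
set P := spectralmx A; set d := spectral_diag A.
(* The order on [C] is only partial: the negation of [c <= d 0 i] gives [d 0 i < c] because both are
   real. *)
have dreal i : d 0 i \is Num.real.
  by have /mxOverP := hermitian_spectral_diag_real hermA; apply.
have Punitary : P \is unitarymx by exact: spectral_unitarymx.
have EA : A = P^t* *m diag_mx d *m P.
  rewrite -(invmx_unitary Punitary).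
  exact/orthomx_spectralP/hermitian_normalmx.
(* [E] keeps the columns of [U *m P^t*] indexed by [S]. Having fewer columns than rows, it kills
   some nonzero [x]; the coordinates [w] of [x *m U] in the eigenbasis then vanish on [S]. *)
pose E := \matrix_(i < k, j < #|S|) (U *m P^t* ) i (enum_val j).
have /rowV0Pn[x /sub_kermxP xE x0] : kermx E != 0.
  rewrite kermx_eq0 /row_free neq_ltn.
  by rewrite (leq_ltn_trans (rank_leq_col E) ltk).
pose w := x *m U *m P^t*.
have wS i : i \in S -> w 0 i = 0.
  move=> iS; have /rowP/(_ (enum_rank_in iS i)) := xE.
  rewrite [X in _ = X -> _]mxE => <-; rewrite /w -mulmxA mxE [RHS]mxE.
  by apply: eq_bigr => j _; rewrite [in RHS]mxE enum_rankK_in.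
have xU : x *m U = w *m P.
  by rewrite /w -mulmxA -(invmx_unitary Punitary) mulVmx ?mulmx1 ?spectral_unit.
have xUadj : (x *m U)^t* = P^t* *m w^t*.
  by rewrite xU trmx_mul map_mxM.
have PPadj : P *m P^t* = 1%:M by apply/unitarymxP.
have := leform x; rewrite xUadj.
have -> : x *m U *m (P^t* *m w^t* ) = w *m w^t* by rewrite mulmxA.
have -> : x *m U *m A *m (P^t* *m w^t* ) = w *m diag_mx d *m w^t*.
  rewrite EA xU !mulmxA -(mulmxA w P) PPadj mulmx1.
  by rewrite -(mulmxA (w *m diag_mx d) P) PPadj mulmx1.
rewrite dotmx_sum diag_form_sum mulr_sumr => /le_gtF/negbT/negP[].
have w0 : w != 0.
  apply: contraNneq x0 => w0; rewrite -(mulmx_free_eq0 x Ufree) xU w0.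
  by rewrite mul0mx.
have [i wi0] : exists i, w 0 i != 0.
  by have /rV0Pn := w0.
have lei j : d 0 j * `|w 0 j| ^+ 2 <= c * `|w 0 j| ^+ 2.
  have [jS|jS] := boolP (j \in S); first by rewrite wS// normr0 expr0n !mulr0.
  rewrite ler_wpM2r ?exprn_ge0//; apply: ltW.
  by rewrite real_ltNge.
(* Strictness comes from the index [i] with [w 0 i != 0], which lies outside [S]. *)
rewrite [ltLHS](bigD1 i)//= [ltRHS](bigD1 i)//= ltr_leD ?ler_sum//.
rewrite ltr_pM2r ?exprn_gt0 ?normr_gt0// real_ltNge//.
by apply: contraNN wi0 => iS; rewrite wS.
Qed.

(** On the first [k] coordinates the quadratic form of [A] is that of [diag_mx s], hence at least
    [c] times the squared norm. Over [R[i]] the matrix is Hermitian with real eigenvalues, whose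
    real parts factor the characteristic polynomial back over [R]. *)
Lemma symmetric_block_count_ge (R : rcfType) k m (s : 'rV[R]_k) (B : 'M_(k, m))
    (C : 'M_(m, k)) (D : 'M_m) (c : R) :
  let A := block_mx (diag_mx s) B C D in
  A^T = A -> (forall i, c <= s 0 i) ->
  exists2 e : seq R, char_poly A = \prod_(x <- e) ('X - x%:P) &
    (k <= count (fun x => c <= x)%R e)%N.
Proof.
move=> A symA sge; pose toC := real_complex R; pose AC := map_mx toC A.
have ACreal : AC \is a mxOver Num.real.
  by apply/mxOverP => i j; rewrite mxE; apply/complex_realP; eexists.
have hermA : AC \is hermsymmx.
  apply: realsym_hermsym => //; apply/is_hermitianmxP.
  by rewrite expr0 scale1r map_mx_id// /AC map_trmx symA.
pose e := [seq complex.Re (spectral_diag AC 0 i) | i : 'I_(k + m)].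
have Ree i : toC (complex.Re (spectral_diag AC 0 i)) = spectral_diag AC 0 i.
  apply: RRe_real.
  by have /mxOverP := hermitian_spectral_diag_real hermA; apply.
exists e.
  apply: (map_poly_inj toC); rewrite map_char_poly char_poly_hermitian//.
  rewrite rmorph_prod big_image/=; apply: eq_bigr => i _.
  rewrite rmorphB/= map_polyX map_polyC/=.
  by congr (_ - _%:P); exact/esym/Ree.
have -> : count (fun x => c <= x) e =
    #|[pred i | (c <= complex.Re (spectral_diag AC 0 i))%R]|.
  by rewrite cardE /enum_mem size_filter count_map enumT.
(* The rows of [U] are the first [k] coordinate vectors. *)
pose U : 'M[R[i]]_(k, k + m) := row_mx 1%:M 0.
have UAU x : x *m U *m AC *m (x *m U)^t* =
    x *m diag_mx (map_mx toC s) *m x^t*.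
  rewrite trmx_mul map_mxM/= tr_row_mx trmx0 trmx1 map_col_mx map_mx1 map_mx0.
  rewrite /AC map_block_mx map_diag_mx -!mulmxA; congr (_ *m _).
  rewrite !mulmxA mul_row_block mul_row_col !mul1mx !mul0mx !addr0 mulmx0 addr0.
  by rewrite mulmx1.
have UU x : x *m U *m (x *m U)^t* = x *m x^t*.
  rewrite trmx_mul map_mxM/= tr_row_mx trmx0 trmx1 map_col_mx map_mx1 map_mx0.
  rewrite -!mulmxA; congr (_ *m _).
  by rewrite mulmxA mul_row_col !mul1mx mul0mx addr0 mul1mx.
have Ufree : row_free U.
  apply/row_freeP; exists (col_mx 1%:M 0).
  by rewrite mul_row_col mulmx1 mul0mx addr0.
have creal : toC c \is Num.real by apply/complex_realP; eexists.
apply: leq_trans (hermitian_count_ge hermA creal Ufree _) _.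
  move=> x; rewrite UAU UU dotmx_sum diag_form_sum mulr_sumr.
  by apply: ler_sum => i _; rewrite mxE ler_wpM2r ?exprn_ge0// lecR.
by apply: subset_leq_card; apply/subsetP => i; rewrite !inE -Ree lecR.
Qed.

(** Root multiplicities in a split polynomial are occurrence counts in [e], so the definition merely
    regroups [e] by value. *)
Lemma singular_values_perm (R : rcfType) n (A : 'M[R]_n) (e : seq R) :
  char_poly (A^T *m A) = \prod_(x <- e) ('X - x%:P) ->
  perm_eq (singular_values A) [seq Num.sqrt x | x <- e].
Proof.
move=> chiE; rewrite /singular_values chiE; set p := \prod_(_ <- _) _.
have p0 : p != 0 by rewrite monic_neq0// monic_prod_XsubC.
have -> : flatten [seq nseq (mup x p) (Num.sqrt x) | x <- rootsR p] =
    map Num.sqrt (flatten [seq nseq (count_mem x e) x | x <- rootsR p]).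
  rewrite map_flatten -map_comp; congr flatten; apply: eq_map => x /=.
  by rewrite map_nseq mu_prod_XsubC.
apply: perm_map; apply: perm_trans (perm_count_undup e).
apply/perm_flatten/perm_map/uniq_perm; rewrite ?undup_uniq ?uniq_roots// => x.
by rewrite mem_undup -(roots_on_rootsR p0) inE/= root_prod_XsubC.
Qed.

Lemma split_index_ge (R : rcfType) (tau : R) k m (S : 'M_k) (B : 'M_(k, m))
    (C : 'M_(m, k)) (D : 'M_m) :
  0 < tau -> (0 < m)%N -> (forall i : 'I_k, tau <= S i i) ->
  (k <= split_index tau (block_mx S B C D))%N.
Proof.
move=> tau0 m0 Sge; rewrite leqNgt; apply/negP => ltk.
set A := block_mx S B C D in ltk *.
set t := fun j : 'I_(k + m) =>
  `|A j j| <= Num.sqrt (2 / ((k + m - j) * (k + m - j + 1))%:R) * tau.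
have hast : has t (enum 'I_(k + m)).
  by rewrite has_find size_enum_ord (leq_trans ltk)// leq_addr.
have := nth_find (lshift m (Ordinal ltk)) hast.
rewrite -/(split_index tau A) => tj.
set j := nth _ _ _ in tj.
have jE : j = split_index tau A :> nat.
  by rewrite /j nth_enum_ord// (leq_trans ltk)// leq_addr.
have jl : j = lshift m (Ordinal ltk) by apply: val_inj.
(* Since [j < k] and [m >= 1], the factors of [N] are at least 2 and 3. Thus [2 / N < 1], and the
   threshold at [j] falls below [tau]. *)
have a1 : (1 < k + m - j)%N
  by rewrite ltn_subRL jE addn1 (leq_ltn_trans ltk)// -{1}[k]addn0 ltn_add2l.
set N := ((k + m - j) * (k + m - j + 1))%N in tj.
have N2 : (2 < N)%N by rewrite (@leq_trans (2 * 3))// leq_mul// addn1 ltnS.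
have : tau <= Num.sqrt (2 / N%:R) * tau.
  apply: le_trans tj; rewrite jl block_mxEul.
  exact: le_trans (Sge _) (ler_norm _).
apply/negP; rewrite -ltNge gtr_pMl// -[ltRHS]sqrtr1 ltr_sqrt//.
have N0 : (0 < N)%N by exact: ltn_trans N2.
by rewrite ltr_pdivrMr ?mul1r ?ltr_nat ?ltr0n.
Qed.

(** An erased entry has both indices at least [l >= k], so it lies in the lower right block. *)
Lemma zero_trailing_block_mx (R : rcfType) k m (S : 'M[R]_k) (B : 'M_(k, m))
    (C : 'M_(m, k)) (D : 'M_m) l :
  (k <= l)%N ->
  exists D' : 'M_m, zero_trailing_block l (block_mx S B C D) = block_mx S B C D'.
Proof.
move=> kl; set A := block_mx S B C D.
exists (drsubmx (zero_trailing_block l A)).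
rewrite -[LHS]submxK; congr block_mx; apply/matrixP => i j;
  do 3![rewrite mxE/=]; rewrite ?(leqNgt l) ?(leq_trans (ltn_ord i) kl);
  rewrite ?(leq_trans (ltn_ord j) kl)/= ?andbF.
- by rewrite block_mxEul.
- by rewrite block_mxEur.
- by rewrite block_mxEdl.
Qed.

Theorem lemma3p5 (R : rcfType) (tau : R) (rk mk p : nat)
    (Sigma : 'M[R]_rk) (star : 'M[R]_(rk, mk)) (Rt : 'M[R]_mk)
    (B : 'M[R]_(p, mk)) (s : 'S_mk) (Q : 'M[R]_(p, mk)) :
  0 < tau -> (1 <= rk)%N -> (1 <= mk)%N ->
  is_diag_mx Sigma -> (forall i : 'I_rk, tau <= Sigma i i) ->
  pivoted_qr B s Q Rt ->
  (rk <= thresholded_rank tau (block_mx Sigma star 0 Rt))%N.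
Proof.
move=> tau0 _ mk0 /diag_mxP[d ->] Sge _.
have dge i : tau <= d 0 i by have := Sge i; rewrite mxE eqxx mulr1n.
have kl := split_index_ge star 0 Rt tau0 mk0 Sge.
rewrite /thresholded_rank /retained_singular_values.
have [D ->] := zero_trailing_block_mx (diag_mx d) star 0 Rt kl.
set M := block_mx _ _ _ D.
(* The first [rk] columns of [M] are [diag_mx d] above zero, so the leading block of the Gram matrix
   is diagonal whatever [star] and [D] are. *)
have ME : M^T *m M = block_mx (diag_mx (\row_i (d 0 i * d 0 i)))
    (diag_mx d *m star) (star^T *m diag_mx d) (star^T *m star + D^T *m D).
  rewrite tr_block_mx mulmx_block tr_diag_mx trmx0 mulmx_diag.
  by rewrite !mulmx0 !mul0mx !addr0.
have symM : (M^T *m M)^T = M^T *m M by rewrite trmx_mul trmxK.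
rewrite ME in symM.
have sqge i : tau ^+ 2 <= (\row_i (d 0 i * d 0 i)) 0 i.
  by rewrite mxE -expr2 ler_sqr ?nnegrE ?(le_trans (ltW tau0)).
have [e] := symmetric_block_count_ge symM sqge.
rewrite -ME => /singular_values_perm/perm_filter/perm_size-> /leq_trans; apply.
rewrite size_filter count_map; apply: sub_count => x /= tau2x.
(* As [tau] is positive, it equals the square root of [tau ^+ 2], and square roots are monotone. *)
rewrite -(ger0_norm (ltW tau0)) -sqrtr_sqr ler_sqrt//.
exact: le_trans (sqr_ge0 _) tau2x.
Qed.
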